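(* Let $A$ be a compliant Banach algebra with a bounded approximate identity. Then $M(A)$ is weak*-topologically left Noetherian if and only if every closed left ideal $I$ in $A$ has the form $$I=\overline{A\mu_1+\cdots+A\mu_n}$$ (norm closure) for some $n\in\mathbb{N}$ and some $\mu_1,\ldots,\mu_n\in M(A)$.
   Context: A Banach algebra $A$ is faithful if $Ax=\{0\}$ implies $x=0$ and $xA=\{0\}$ implies $x=0$ ($x\in A$). The multiplier algebra $M(A)$ of a faithful Banach algebra $A$ is the unital Banach algebra of pairs $\mu=(L,R)$ of bounded linear maps $A\to A$ with $aL(b)=R(a)b$ for all $a,b\in A$, with product $(L,R)(L',R')=(LL',R'R)$ and norm $\max(\|L\|,\|R\|)$; one writes $\mu a=L(a)$ and $a\mu=R(a)$. $A$ is identified with its image in $M(A)$ under the canonical map sending $a$ to (left multiplication by $a$, right multiplication by $a$). A dual Banach algebra is a Banach algebra that is (isomorphically) a dual Banach space in such a way that multiplication is separately weak*-continuous. A Banach algebra $A$ is compliant if it is faithful and $M(A)$ is a dual Banach algebra in such a way that, for each $a\in A$, the maps $M(A)\to A$, $\mu\mapsto\mu a$ and $\mu\mapsto a\mu$, are continuous from the weak*-topology of $M(A)$ to the weak topology of $A$; the weak*-topology of $M(A)$ refers to this dual structure. A unital dual Banach algebra $B$ is weak*-topologically left Noetherian if for every weak*-closed left ideal $J$ of $B$ there exist $n\in\mathbb{N}$ and $x_1,\ldots,x_n\in J$ with $J=\overline{Bx_1+\cdots+Bx_n}^{w^*}$. Bounded approximate identities are two-sided. *)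

(* Defs.v *)
From HB Require Import structures.
From mathcomp Require Import all_boot all_order all_algebra.
From mathcomp Require Import complex.
From mathcomp Require Import all_classical all_reals all_analysis.
From mathcomp Require Import ring.

Set Implicit Arguments.
Unset Strict Implicit.
Unset Printing Implicit Defensive.

Import Order.TTheory GRing.Theory Num.Theory.
Import numFieldNormedType.Exports.

Local Open Scope classical_set_scope.
Local Open Scope complex_scope.
Local Open Scope ring_scope.

(* Neither a unit nor 1 != 0 is required, so the library's (unital) algebra
   structures do not apply. *)
HB.mixin Record isBanachAlgebra (K : numFieldType) A
    & CompleteNormedModule K A := {
  bmul : A -> A -> A;
  bmulA : associative bmul;
  bmulDl : left_distributive bmul +%R;
  bmulDr : right_distributive bmul +%R;
  bmulZl : forall (k : K) a b, bmul (k *: a) b = k *: bmul a b;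
  bmulZr : forall (k : K) a b, bmul a (k *: b) = k *: bmul a b;
  bmul_norm : forall a b, `|bmul a b| <= `|a| * `|b|
}.

#[short(type="banachAlgType")]
HB.structure Definition BanachAlgebra (K : numFieldType) :=
  {A of CompleteNormedModule K A & isBanachAlgebra K A}.

HB.mixin Record isUnitalBanachAlgebra (K : numFieldType) A
    & BanachAlgebra K A := {
  bone : A;
  bmul1x : left_id bone bmul;
  bmulx1 : right_id bone bmul
}.

#[short(type="unitalBanachAlgType")]
HB.structure Definition UnitalBanachAlgebra (K : numFieldType) :=
  {A of BanachAlgebra K A & isUnitalBanachAlgebra K A}.

Section ComplexBanachAlgebras.
Context {R : realType}.
Local Notation C := R[i].

Section BoundedLinear.
Variables (E F : normedModType C).

Definition bounded_linear : {pred E -> F} := fun f =>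
  `[< linear f /\ exists M : R, forall x, `|f x| <= M%:C * `|x| >].

Lemma bounded_linearP f : reflect
  (linear f /\ exists M : R, forall x, `|f x| <= M%:C * `|x|)
  (f \in bounded_linear).
Proof. exact: asboolP. Qed.

Record blin := Blin { blin_val :> E -> F; blinP : blin_val \in bounded_linear }.
HB.instance Definition _ := [isSub for blin_val].
HB.instance Definition _ := [Choice of blin by <:].

Lemma bounded_linear_submod : submod_closed bounded_linear.
Proof.
split.
  apply/bounded_linearP; split; first by move=> a x y /=; rewrite scaler0 addr0.
  by exists 0 => x; rewrite normr0 mul0r.
move=> k f g /bounded_linearP[lf [M fM]] /bounded_linearP[lg [N gN]].
apply/bounded_linearP; split.
  move=> a x y.
  change (k *: f (a *: x + y) + g (a *: x + y) =
          a *: (k *: f x + g x) + (k *: f y + g y)).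
  by rewrite lf lg !scalerDr !scalerA (mulrC k) addrACA.
exists (complex.Re `|k| * M + N) => x.
apply: (le_trans (ler_normD _ _)).
rewrite rmorphD rmorphM /= mulrDl lerD// normrZ.
have -> : (complex.Re `|k|)%:C = `|k| by rewrite RRe_real// normr_real.
by rewrite -mulrA ler_wpM2l.
Qed.
HB.instance Definition _ :=
  GRing.isSubmodClosed.Build C (E -> F) bounded_linear bounded_linear_submod.
HB.instance Definition _ := [SubChoice_isSubLmodule of blin by <:].


Lemma blin_bounded (f : blin) : exists M : R, forall x, `|f x| <= M%:C * `|x|.
Proof. by have /bounded_linearP[] := blinP f. Qed.

HB.instance Definition _ (f : blin) :=
  GRing.isLinear.Build C E F _ f (proj1 (elimT (bounded_linearP f) (blinP f))).

Lemma blinDE (f g : blin) x : (f + g) x = f x + g x. Proof. by []. Qed.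
Lemma blinNE (f : blin) x : (- f) x = - f x. Proof. by []. Qed.
Lemma blinBE (f g : blin) x : (f - g) x = f x - g x. Proof. by []. Qed.
Lemma blinZE (k : C) (f : blin) x : (k *: f) x = k *: f x. Proof. by []. Qed.
Lemma blin0E x : (0 : blin) x = 0. Proof. by []. Qed.

Lemma blinEP (f g : blin) : (f : E -> F) =1 g -> f = g.
Proof. by move=> fg; apply/val_inj/funext. Qed.

Let normRe (V : normedModType C) (v : V) : (complex.Re `|v|)%:C = `|v|.
Proof. by rewrite RRe_real// normr_real. Qed.

(* A normed module over R[i] has its norm valued in R[i], so the real supremum
   is embedded back into R[i]. *)
Definition opnorm (f : blin) : C :=
  (sup [set complex.Re `|f x| | x in [set x : E | `|x| <= 1]])%:C.

Let has_sup_opnorm (f : blin) :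
  has_sup [set complex.Re `|f x| | x in [set x : E | `|x| <= 1]].
Proof.
split; first by exists (complex.Re `|f 0|), 0 => //=; rewrite normr0.
have [M fM] := blin_bounded f; exists `|M| => _ [x /= x1 <-].
rewrite -lecR normRe (le_trans (fM x))//.
apply: (@le_trans _ _ (`|M|%:C * `|x|)).
  by rewrite ler_wpM2r// lecR ler_norm.
by rewrite ler_piMr// lecR.
Qed.

Lemma opnorm_ge0 (f : blin) : 0 <= opnorm f.
Proof.
apply: (@le_trans _ _ `|f 0|) => //; rewrite -normRe lecR.
apply: sup_ubound; first by case: (has_sup_opnorm f).
by exists 0 => //=; rewrite normr0.
Qed.

Lemma le_opnorm (f : blin) x : `|f x| <= opnorm f * `|x|.
Proof.
have [->|x0] := eqVneq x 0; first by rewrite linear0 !normr0 mulr0.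
have nx : 0 < `|x| by rewrite normr_gt0.
rewrite -ler_pdivrMr// mulrC -[X in X * _]ger0_norm ?invr_ge0// -normrZ -linearZ/=.
rewrite -[X in X <= _]normRe lecR; apply: sup_ubound; first by case: (has_sup_opnorm f).
exists (`|x|^-1 *: x) => //=.
by rewrite normrZ ger0_norm ?invr_ge0// mulVf ?gt_eqF.
Qed.

Lemma opnorm_le (f : blin) (M : C) : 0 <= M ->
  (forall x, `|f x| <= M * `|x|) -> opnorm f <= M.
Proof.
move=> M0 fM; have <- : (complex.Re M)%:C = M by rewrite RRe_real// ger0_real.
rewrite lecR; apply: ge_sup; first by case: (has_sup_opnorm f).
move=> _ [x /= x1 <-]; rewrite -lecR normRe RRe_real ?ger0_real//.
by rewrite (le_trans (fM x))// ler_piMr.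
Qed.

Lemma opnormD (f g : blin) : opnorm (f + g) <= opnorm f + opnorm g.
Proof.
apply: opnorm_le => [|x]; first by rewrite addr_ge0 ?opnorm_ge0.
by rewrite mulrDl (le_trans (ler_normD _ _))// lerD ?le_opnorm.
Qed.

Lemma opnormZ (k : C) (f : blin) : opnorm (k *: f) = `|k| * opnorm f.
Proof.
have le k' g : opnorm (k' *: g) <= `|k'| * opnorm g.
  apply: opnorm_le => [|x]; first by rewrite mulr_ge0 ?opnorm_ge0.
  by rewrite normrZ -mulrA ler_wpM2l ?le_opnorm.
apply/le_anti; rewrite le/=.
have [->|k0] := eqVneq k 0; first by rewrite normr0 mul0r opnorm_ge0.
rewrite -ler_pdivlMl ?normr_gt0//.
by have := le k^-1 (k *: f); rewrite scalerK// normfV.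
Qed.

Lemma opnorm0_eq0 (f : blin) : opnorm f = 0 -> f = 0.
Proof.
move=> f0; apply/blinEP => x; apply/normr0_eq0/le_anti.
by rewrite normr_ge0 (le_trans (le_opnorm f x))// f0 mul0r.
Qed.

HB.instance Definition _ :=
  Lmodule_isNormed.Build C blin opnormD opnormZ opnorm0_eq0.

Lemma blin_normE (f : blin) : `|f| = opnorm f. Proof. by []. Qed.

Lemma blin_norm_le (f : blin) x : `|f x| <= `|f| * `|x|.
Proof. exact: le_opnorm. Qed.

End BoundedLinear.

Section BoundedLinearComplete.
Variables (E : normedModType C) (F : completeNormedModType C).

Lemma blin_complete (G : set_system (blin E F)) :
  ProperFilter G -> cauchy G -> cvg G.
Proof.
move=> PG /cauchyP cG.
have cvg_at x : cvg (((fun f : blin E F => f x) @ G)).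
  apply: cauchy_cvg; apply: cauchy_exP => e e0.
  have d0 : 0 < e / (`|x| + 1) by rewrite divr_gt0// ltr_wpDl.
  have [f0 Gf0] := cG _ d0; exists (f0 x).
  change (G [set f : blin E F | ball (f0 x) e (f x)]).
  apply: filterS Gf0 => f; rewrite -!ball_normE /ball_/= => ff0.
  rewrite -blinBE (le_lt_trans (blin_norm_le _ _))//.
  have x1 : 0 < `|x| + 1 by rewrite ltr_wpDl.
  rewrite (@le_lt_trans _ _ (`|f0 - f| * (`|x| + 1)))//.
    by rewrite ler_wpM2l// lerDl.
  by rewrite -ltr_pdivlMr.
pose l x := lim (((fun f : blin E F => f x) @ G)).
have lP x : ((fun f : blin E F => f x) @ G) --> l x by exact: cvg_at.
have l_lin : linear l.
  move=> a x y; have llin : ((fun f : blin E F => f (a *: x + y)) @ G) --> a *: l x + l y.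
    under eq_fun do rewrite linearP.
    by apply: cvgD; [apply: cvgZl_tmp|]; exact: lP.
  exact: (@cvg_unique _ (@norm_hausdorff C F) _ _ _ _ (lP _) llin).
have approx f0 e : 0 < e -> G (ball f0 e) ->
    forall x, `|f0 x - l x| <= (e + e) * `|x|.
  move=> e0 Gf0 x; have [->|x0] := eqVneq x 0.
    have l0 : l 0 = 0 by have := l_lin (-1) 0 0; rewrite scaler0 addr0 scaleN1r addNr.
    by rewrite linear0 l0 subr0 !normr0 mulr0.
  have ex0 : 0 < e * `|x| by rewrite mulr_gt0// normr_gt0.
  have /cvgrPdist_lt/(_ _ ex0) Gl := lP x.
  have [f []] := filter_ex (filterI Gf0 Gl).
  rewrite -ball_normE /ball_/= => ff0 fl.
  rewrite mulrDl -(subrK (f x) (f0 x)) -addrA (le_trans (ler_normD _ _))//.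
  rewrite lerD ?(distrC (f x) (l x)) ?(ltW fl)//.
  by rewrite -blinBE (le_trans (blin_norm_le _ _))// ler_wpM2r// ltW.
have l_bl : l \in @bounded_linear E F.
  apply/bounded_linearP; split => //.
  have [f0 Gf0] := cG 1 ltr01; have fl := approx _ _ ltr01 Gf0.
  exists (complex.Re (`|f0| + (1 + 1))) => x.
  rewrite RRe_real ?ger0_real ?addr_ge0// mulrDl.
  rewrite -(subrK (f0 x) (l x)) addrC (le_trans (ler_normD _ _))//.
  by rewrite lerD ?blin_norm_le// distrC.
apply/cvg_ex; exists (Blin l_bl); apply/cvgrPdist_lt => e e0.
have e4 : 0 < e / 4%:R by rewrite divr_gt0.
have [f0 Gf0] := cG _ e4; have fl := approx _ _ e4 Gf0.
apply: filterS (Gf0) => f; rewrite -ball_normE /ball_/= => ff0.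
rewrite -(subrK f0 (Blin l_bl)) -addrA (le_lt_trans (ler_normD _ _))//.
have -> : e = (e / 4%:R + e / 4%:R) + (e / 4%:R + e / 4%:R) by field.
rewrite ler_ltD//; last first.
  by rewrite (lt_trans ff0)// ltrDl.
apply: opnorm_le => [|x]; first by rewrite addr_ge0// ltW.
by rewrite blinBE distrC; exact: fl.
Qed.

HB.instance Definition _ := Uniform_isComplete.Build (blin E F) blin_complete.
End BoundedLinearComplete.

Section BoundedLinearComp.
Variables E F G : normedModType C.

Lemma blin_comp_subproof (g : blin F G) (f : blin E F) :
  (g : F -> G) \o f \in @bounded_linear E G.
Proof.
apply/bounded_linearP; split=> [a x y /=|]; first by rewrite !linearP.
exists (complex.Re (`|g| * `|f|)) => x.
rewrite RRe_real ?ger0_real ?mulr_ge0// -mulrA (le_trans (blin_norm_le _ _))//.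
by rewrite ler_wpM2l ?blin_norm_le.
Qed.

Definition blin_comp (g : blin F G) (f : blin E F) : blin E G :=
  Blin (blin_comp_subproof g f).

Lemma blin_compE g f x : blin_comp g f x = g (f x). Proof. by []. Qed.

Lemma blin_comp_norm g f : `|blin_comp g f| <= `|g| * `|f|.
Proof.
apply: opnorm_le => [|x]; first by rewrite mulr_ge0.
rewrite blin_compE -mulrA (le_trans (blin_norm_le _ _))//.
by rewrite ler_wpM2l ?blin_norm_le.
Qed.

End BoundedLinearComp.

Lemma blin_id_subproof (E : normedModType C) : @idfun E \in @bounded_linear E E.
Proof. by apply/bounded_linearP; split => //; exists 1 => x; rewrite mul1r. Qed.

Definition blin_id (E : normedModType C) : blin E E := Blin (blin_id_subproof E).

Section Multiplier.
Variable A : banachAlgType C.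

Definition faithful :=
  (forall x : A, (forall a : A, bmul a x = 0) -> x = 0) /\
  (forall x : A, (forall a : A, bmul x a = 0) -> x = 0).

Definition is_multiplier : {pred blin A A * blin A A} := fun m : blin A A * blin A A =>
  `[< forall a b, bmul a (m.1 b) = bmul (m.2 a) b >].

Lemma is_multiplierP (m : blin A A * blin A A) : reflect
  (forall a b, bmul a (m.1 b) = bmul (m.2 a) b) (m \in is_multiplier).
Proof. exact: asboolP. Qed.

Record multiplier := Multiplier {
  multiplier_val : (blin A A * blin A A)%type;
  multiplierP : multiplier_val \in is_multiplier
}.
HB.instance Definition _ := [isSub for multiplier_val].
HB.instance Definition _ := [Choice of multiplier by <:].

Let bmul0x (a : A) : bmul 0 a = 0.
Proof. by have := bmulZl 0 0 a; rewrite !scale0r. Qed.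
Let bmulx0 (a : A) : bmul a 0 = 0.
Proof. by have := bmulZr 0 a 0; rewrite !scale0r. Qed.

Let pair_linE (V : lmodType C) (k : C) (x y : V * V) :
  k *: x + y = (k *: x.1 + y.1, k *: x.2 + y.2).
Proof. by []. Qed.

Lemma is_multiplier_submod : submod_closed is_multiplier.
Proof.
split.
  apply/is_multiplierP => a b; change (bmul a (0 : A) = bmul (0 : A) b).
  by rewrite bmul0x bmulx0.
move=> k m m' /is_multiplierP mP /is_multiplierP m'P; apply/is_multiplierP => a b.
rewrite pair_linE /=.
change (bmul a (k *: m.1 b + m'.1 b) = bmul (k *: m.2 a + m'.2 a) b).
by rewrite bmulDr bmulDl bmulZr bmulZl mP m'P.
Qed.
HB.instance Definition _ := GRing.isSubmodClosed.Build C (blin A A * blin A A)%type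
  is_multiplier is_multiplier_submod.
HB.instance Definition _ := [SubChoice_isSubLmodule of multiplier by <:].

(* For mu = (L, R), the products mu a = L a and a mu = R a. *)
Definition lmult (mu : multiplier) : blin A A := (multiplier_val mu).1.
Definition rmult (mu : multiplier) : blin A A := (multiplier_val mu).2.

Lemma lrmultP mu a b : bmul a (lmult mu b) = bmul (rmult mu a) b.
Proof. exact/is_multiplierP/multiplierP. Qed.

Lemma multiplierEP mu nu : lmult mu = lmult nu -> rmult mu = rmult nu -> mu = nu.
Proof.
move: mu nu => [[l r] p] [[l' r'] p'] /= ll rr; apply: val_inj => /=.
by move: ll rr; rewrite /lmult /rmult/= => -> ->.
Qed.

Lemma lmultD mu nu : lmult (mu + nu) = lmult mu + lmult nu. Proof. by []. Qed.
Lemma rmultD mu nu : rmult (mu + nu) = rmult mu + rmult nu. Proof. by []. Qed.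
Lemma lmultB mu nu : lmult (mu - nu) = lmult mu - lmult nu. Proof. by []. Qed.
Lemma rmultB mu nu : rmult (mu - nu) = rmult mu - rmult nu. Proof. by []. Qed.
Lemma lmultZ (k : C) mu : lmult (k *: mu) = k *: lmult mu. Proof. by []. Qed.
Lemma rmultZ (k : C) mu : rmult (k *: mu) = k *: rmult mu. Proof. by []. Qed.

Definition multiplier_norm (mu : multiplier) : C := Num.max `|lmult mu| `|rmult mu|.

Let norm_comparable (u v : blin A A) : (`|u| >=< `|v|)%R.
Proof. by apply: real_comparable; exact: normr_real. Qed.

Let lmult_le (mu : multiplier) : `|lmult mu| <= multiplier_norm mu.
Proof. by rewrite /multiplier_norm comparable_le_max ?lexx. Qed.

Let rmult_le (mu : multiplier) : `|rmult mu| <= multiplier_norm mu.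
Proof. by rewrite /multiplier_norm comparable_le_max ?lexx ?orbT. Qed.

Lemma multiplier_normD mu nu :
  multiplier_norm (mu + nu) <= multiplier_norm mu + multiplier_norm nu.
Proof.
rewrite {1}/multiplier_norm comparable_ge_max// lmultD rmultD.
by apply/andP; split; rewrite (le_trans (ler_normD _ _))// lerD.
Qed.

Lemma multiplier_normZ (k : C) mu :
  multiplier_norm (k *: mu) = `|k| * multiplier_norm mu.
Proof. by rewrite /multiplier_norm lmultZ rmultZ !normrZ maxr_pMr. Qed.

Lemma multiplier_norm0_eq0 mu : multiplier_norm mu = 0 -> mu = 0.
Proof.
move=> mu0; apply: multiplierEP; apply/normr0_eq0/le_anti.
  by rewrite normr_ge0 -mu0 lmult_le.
by rewrite normr_ge0 -mu0 rmult_le.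
Qed.

HB.instance Definition _ := Lmodule_isNormed.Build C multiplier
  multiplier_normD multiplier_normZ multiplier_norm0_eq0.

Lemma multiplier_normE (mu : multiplier) : `|mu| = Num.max `|lmult mu| `|rmult mu|.
Proof. by []. Qed.

Lemma lmult_norm (mu : multiplier) : `|lmult mu| <= `|mu|.
Proof. exact: lmult_le. Qed.

Lemma rmult_norm (mu : multiplier) : `|rmult mu| <= `|mu|.
Proof. exact: rmult_le. Qed.

Lemma multiplier_complete (G : set_system multiplier) :
  ProperFilter G -> cauchy G -> cvg G.
Proof.
move=> PG /cauchyP cG.
have cvg_of (p : multiplier -> blin A A) :
    (forall mu nu, `|p mu - p nu| <= `|mu - nu|) -> cvg (p @ G).
  move=> pB; apply: cauchy_cvg; apply: cauchy_exP => e e0.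
  have [mu Gmu] := cG _ e0; exists (p mu).
  change (G [set nu | ball (p mu) e (p nu)]).
  apply: filterS Gmu => nu; rewrite -!ball_normE /ball_/=.
  exact/le_lt_trans/pB.
have cL : cvg (lmult @ G) by apply: cvg_of => mu nu; exact: lmult_norm.
have cR : cvg (rmult @ G) by apply: cvg_of => mu nu; exact: rmult_norm.
pose L : blin A A := lim (lmult @ G); pose T : blin A A := lim (rmult @ G).
have LT : (L, T) \in is_multiplier.
  apply/is_multiplierP => a b /=; apply/eqP; rewrite -subr_eq0.
  suff le_eps (e : C) : 0 < e -> `|bmul a (L b) - bmul (T a) b| <= e.
    apply: contraT; rewrite -normr_gt0 => d0.
    have := le_eps _ (divr_gt0 d0 (ltr0Sn C 1)).
    by rewrite ler_pdivlMr// mulr_natr mulr2n gerDl lt_geF.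
  move=> e0.
  pose M := (`|a| * `|b|) + (`|a| * `|b|) + 1.
  have M0 : 0 < M by rewrite ltr_wpDl// addr_ge0// mulr_ge0.
  have eM : 0 < e / M by rewrite divr_gt0.
  have /cvgrPdist_lt/(_ _ eM) GL := cL.
  have /cvgrPdist_lt/(_ _ eM) GT := cR.
  have [mu [/= Lmu Tmu]] := filter_ex (filterI GL GT).
  have bmulN (x y : A) : bmul (- x) y = - bmul x y.
    by rewrite -(scaleN1r x) bmulZl scaleN1r.
  have bmulNr (x y : A) : bmul x (- y) = - bmul x y.
    by rewrite -(scaleN1r y) bmulZr scaleN1r.
  have -> : bmul a (L b) - bmul (T a) b =
      bmul a ((L - lmult mu) b) - bmul ((T - rmult mu) a) b.
    rewrite !blinBE bmulDr bmulDl bmulN bmulNr lrmultP opprB.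
    by rewrite addrA subrK.
  rewrite (le_trans (ler_normB _ _))//.
  apply: (@le_trans _ _ (`|a| * (e / M * `|b|) + (e / M * `|a|) * `|b|)).
    rewrite lerD// (le_trans (bmul_norm _ _))//.
      rewrite ler_wpM2l// (le_trans (blin_norm_le _ _))// ler_wpM2r//.
      exact: ltW.
    by rewrite ler_wpM2r// (le_trans (blin_norm_le _ _))// ler_wpM2r// ltW.
  have -> : `|a| * (e / M * `|b|) + e / M * `|a| * `|b| =
      e / M * (`|a| * `|b| + `|a| * `|b|) by ring.
  by rewrite -mulrA ler_piMr ?ltW// mulrC ltr_pdivrMr// mul1r ltrDl.
apply/cvg_ex; exists (Multiplier LT); apply/cvgrPdist_lt => e e0.
have /cvgrPdist_lt/(_ _ e0) GL := cL.
have /cvgrPdist_lt/(_ _ e0) GT := cR.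
apply: filterS (filterI GL GT) => mu [/= Lmu Tmu].
rewrite multiplier_normE comparable_gt_max; last exact: norm_comparable.
by rewrite lmultB rmultB; apply/andP.
Qed.

HB.instance Definition _ := Uniform_isComplete.Build multiplier multiplier_complete.

Lemma multiplier_mul_subproof (mu nu : multiplier) :
  (blin_comp (lmult mu) (lmult nu), blin_comp (rmult nu) (rmult mu))
    \in is_multiplier.
Proof. by apply/is_multiplierP => a b /=; rewrite !lrmultP. Qed.

Definition multiplier_mul (mu nu : multiplier) := Multiplier (multiplier_mul_subproof mu nu).

Lemma multiplier_mulA : associative multiplier_mul.
Proof. by move=> mu nu xi; apply: multiplierEP; exact/blinEP. Qed.

Lemma multiplier_mulDl : left_distributive multiplier_mul +%R.
Proof.
move=> mu nu xi; apply: multiplierEP; apply/blinEP => a //.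
by rewrite rmultD !(blinDE, blin_compE) linearD.
Qed.

Lemma multiplier_mulDr : right_distributive multiplier_mul +%R.
Proof.
move=> mu nu xi; apply: multiplierEP; apply/blinEP => a //.
by rewrite lmultD !(blinDE, blin_compE) linearD.
Qed.

Lemma multiplier_mulZl (k : C) mu nu :
  multiplier_mul (k *: mu) nu = k *: multiplier_mul mu nu.
Proof.
apply: multiplierEP; apply/blinEP => a //.
by rewrite rmultZ !(blinZE, blin_compE) linearZ.
Qed.

Lemma multiplier_mulZr (k : C) mu nu :
  multiplier_mul mu (k *: nu) = k *: multiplier_mul mu nu.
Proof.
apply: multiplierEP; apply/blinEP => a //.
by rewrite lmultZ !(blinZE, blin_compE) linearZ.
Qed.

Lemma multiplier_mul_norm (mu nu : multiplier) :
  `|multiplier_mul mu nu| <= `|mu| * `|nu|.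
Proof.
rewrite [leLHS]multiplier_normE comparable_ge_max//; apply/andP; split.
  by rewrite (le_trans (blin_comp_norm _ _))// ler_pM ?lmult_norm.
by rewrite mulrC (le_trans (blin_comp_norm _ _))// ler_pM ?rmult_norm.
Qed.

HB.instance Definition _ := isBanachAlgebra.Build C multiplier
  multiplier_mulA multiplier_mulDl multiplier_mulDr
  multiplier_mulZl multiplier_mulZr multiplier_mul_norm.

Lemma multiplier_one_subproof : (blin_id A, blin_id A) \in is_multiplier.
Proof. exact/is_multiplierP. Qed.

Definition multiplier_one := Multiplier multiplier_one_subproof.

Lemma multiplier_mul1x : left_id multiplier_one bmul.
Proof. by move=> mu; apply: multiplierEP; exact/blinEP. Qed.

Lemma multiplier_mulx1 : right_id multiplier_one bmul.
Proof. by move=> mu; apply: multiplierEP; exact/blinEP. Qed.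

HB.instance Definition _ := isUnitalBanachAlgebra.Build C multiplier
  multiplier_mul1x multiplier_mulx1.

End Multiplier.

Definition dual_space (E : normedModType C) := blin E C^o.
HB.instance Definition _ (E : normedModType C) := NormedModule.on (dual_space E).

(* initial_topology along a map into a product: the coarsest topology making
   every coordinate (evaluation) continuous. *)
Definition weak_topology (E : normedModType C) :=
  initial_topology (fun x : E => (fun f : dual_space E => f x) : {ptws dual_space E -> C^o}).
HB.instance Definition _ (E : normedModType C) :=
  Topological.on (weak_topology E).

Definition weak_star_topology (B E : normedModType C) (phi : B -> dual_space E) :=
  initial_topology (fun b : B => (phi b : E -> C^o) : {ptws E -> C^o}).
HB.instance Definition _ (B E : normedModType C) (phi : B -> dual_space E) :=
  Topological.on (weak_star_topology phi).

Definition linear_homeomorphism (V W : normedModType C) (phi : V -> W) :=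
  [/\ linear phi, continuous phi &
      exists psi : W -> V, [/\ cancel phi psi, cancel psi phi & continuous psi]].

Record dual_banach_algebra (B : banachAlgType C) := DualBanachAlgebra {
  predual : completeNormedModType C;
  to_dual : B -> dual_space predual;
  to_dual_homeo : linear_homeomorphism to_dual;
  wstar_continuous_mull : forall b,
    continuous (bmul b : weak_star_topology to_dual -> weak_star_topology to_dual);
  wstar_continuous_mulr : forall b,
    continuous (bmul^~ b : weak_star_topology to_dual -> weak_star_topology to_dual)
}.

Definition weak_star (B : banachAlgType C) (D : dual_banach_algebra B) :=
  weak_star_topology (@to_dual B D).
HB.instance Definition _ (B : banachAlgType C) (D : dual_banach_algebra B) :=
  Topological.on (weak_star D).

(* The dual structure on M(A) is data: it determines the weak* topology of M(A),
   which need not be unique. *)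
Record compliant (A : banachAlgType C) := Compliant {
  compliant_faithful : faithful A;
  compliant_dual : dual_banach_algebra (multiplier A);
  compliant_lmult : forall a : A,
    continuous ((fun mu => lmult mu a) : weak_star compliant_dual -> weak_topology A);
  compliant_rmult : forall a : A,
    continuous ((fun mu => rmult mu a) : weak_star compliant_dual -> weak_topology A)
}.

Definition directed (I : Type) (le : I -> I -> Prop) :=
  [/\ inhabited I, (forall i, le i i), (forall j i k, le i j -> le j k -> le i k) &
      forall i j, exists k, le i k /\ le j k].

Definition net_filter (I : Type) (le : I -> I -> Prop) : set_system I :=
  [set S | exists i0, forall i, le i0 i -> S i].

Lemma net_filter_proper (I : Type) (le : I -> I -> Prop) :
  directed le -> ProperFilter (net_filter le).
Proof.
move=> [[i0] lexx letr ledir]; split; first by move=> [i Si]; exact: (Si i).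
split.
- by exists i0.
- move=> P Q [i Pi] [j Qj]; have [k [ik jk]] := ledir i j.
  by exists k => l kl; split; [apply: Pi; exact: letr kl|apply: Qj; exact: letr kl].
- by move=> P Q PQ [i Pi]; exists i => j /Pi /PQ.
Qed.

Definition has_bounded_approximate_identity (A : banachAlgType C) :=
  exists (I : Type) (le : I -> I -> Prop) (e : I -> A),
    [/\ directed le,
        (exists M : R, forall i, `|e i| <= M%:C),
        (forall a, bmul (e i) a @[i --> net_filter le] --> a) &
        (forall a, bmul a (e i) @[i --> net_filter le] --> a)].

Definition left_ideal (B : banachAlgType C) (J : set B) :=
  [/\ J 0, (forall x y, J x -> J y -> J (x + y)), (forall (k : C) x, J x -> J (k *: x)) &
      forall b x, J x -> J (bmul b x)].

Definition wstar_left_noetherian (B : unitalBanachAlgType C)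
    (D : dual_banach_algebra B) :=
  forall J : set B, left_ideal J -> closed (J : set (weak_star D)) ->
  exists (n : nat) (x : 'I_n -> B), (forall i, J (x i)) /\
    J = closure ([set \sum_(i < n) bmul (b i) (x i) | b in [set: 'I_n -> B]]
                   : set (weak_star D)).
End ComplexBanachAlgebras.

(* Main.v *)
(** Closed left ideals I of A correspond to weak*-closed left ideals J of M(A)
    through I |-> weak*-closure of I and J |-> J ∩ A. Along a suitable ultrafilter
    the bounded approximate identity (e_i) converges weak* to 1, by a
    Banach-Alaoglu argument, so e_i mu -> mu weak* with e_i mu in A for every
    multiplier mu. Conversely mu |-> e_i mu is weak*-to-weak continuous and, by
    Hahn-Banach, norm-closed subspaces of A are weakly closed, so whatever lies in
    a weak* closure returns to the norm closure after multiplication by e_i.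
    Generators are transported along this correspondence unchanged.

    Hahn-Banach is obtained from the minimal sublinear functionals below
    x |-> inf {q (x + c) - r | (c, r) in K}, for K a convex cone of constraints
    "the value at c is at least r". *)
From HB Require Import structures.
Require Import Defs.
From mathcomp Require Import all_boot all_order all_algebra.
From mathcomp Require Import complex.
From mathcomp Require Import all_classical all_reals all_analysis.

Set Implicit Arguments.
Unset Strict Implicit.
Unset Printing Implicit Defensive.

Import Order.TTheory GRing.Theory Num.Theory.
Import numFieldNormedType.Exports.

Local Open Scope classical_set_scope.
Local Open Scope complex_scope.
Local Open Scope ring_scope.

(** * Sublinear functionals and the Hahn-Banach theorem over the reals *)

Section Sublinear.
Variables (R : realType) (V : lmodType R).
Implicit Types (p q : V -> R) (K : V -> R -> Prop) (x y : V).

Definition sublinear q :=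
  (forall x y, q (x + y) <= q x + q y) /\
  (forall t x, 0 <= t -> q (t *: x) <= t * q x).

Definition convex_cone K :=
  [/\ K 0 0,
      (forall c d r s, K c r -> K d s -> K (c + d) (r + s)) &
      (forall t c r, 0 <= t -> K c r -> K (t *: c) (t * r))].

Lemma sublinear0 q : sublinear q -> q 0 = 0.
Proof.
move=> [qD qZ]; apply/le_anti/andP; split.
  by have := qZ 0 0 (lexx 0); rewrite scaler0 mul0r.
by have := qD 0 0; rewrite addr0 lerDl.
Qed.

Lemma sublinear_opp q x : sublinear q -> - q (- x) <= q x.
Proof.
move=> sq; rewrite lerNl -subr_ge0 opprK addrC.
by rewrite -(sublinear0 sq) -[X in q X](subrr x); exact: sq.1.
Qed.

Lemma sublinearZ q t x : sublinear q -> 0 <= t -> q (t *: x) = t * q x.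
Proof.
move=> sq; rewrite le_eqVlt => /predU1P[<-|t0].
  by rewrite scale0r sublinear0// mul0r.
apply/le_anti/andP; split; first exact/sq.2/ltW.
rewrite -ler_pdivlMl//.
have := sq.2 t^-1 (t *: x); rewrite scalerK ?gt_eqF//; apply.
by rewrite invr_ge0 ltW.
Qed.

Section ConeMinorant.
Variables (q : V -> R) (K : V -> R -> Prop).
Hypotheses (sq : sublinear q) (cK : convex_cone K).
Hypothesis Kq : forall c r, K c r -> r <= q c.

Let values x := [set s | exists c r, K c r /\ s = q (x + c) - r].

Let has_inf_values x : has_inf (values x).
Proof.
have [K0 _ _] := cK; split; first by exists (q (x + 0) - 0), 0, 0.
(* Since [c = - x + (x + c)], subadditivity gives [r <= q c <= q (- x) + q (x + c)]. *)
exists (- q (- x)) => _ [c [r [Kcr ->]]].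
rewrite lerBrDr -lerBrDl opprK (le_trans (Kq Kcr))//.
by rewrite -{1}(addKr x c) addrC (le_trans (sq.1 _ _))// addrC.
Qed.

Definition cone_minorant x := inf (values x).

Lemma cone_minorant_le x c r : K c r -> cone_minorant x <= q (x + c) - r.
Proof.
move=> Kcr; apply: ge_inf; last by exists c, r.
exact: (has_inf_values x).2.
Qed.

Lemma cone_minorant_ge x s :
  (forall c r, K c r -> s <= q (x + c) - r) -> s <= cone_minorant x.
Proof.
move=> H; apply: lb_le_inf; first exact: (has_inf_values x).1.
by move=> _ [c [r [Kcr ->]]]; exact: H.
Qed.

Lemma cone_minorant_sublinear : sublinear cone_minorant.
Proof.
have [K0 KD KZ] := cK; split=> [x y|t x].
  rewrite -lerBlDr; apply: cone_minorant_ge => c r Kcr.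
  rewrite lerBlDr -lerBlDl; apply: cone_minorant_ge => d s Kds.
  rewrite lerBlDl (le_trans (cone_minorant_le _ (KD _ _ _ _ Kcr Kds)))//.
  rewrite opprD addrACA [leRHS]addrACA lerD2r.
  exact: sq.1.
rewrite le_eqVlt => /predU1P[<-|t0].
  rewrite scale0r mul0r (le_trans (cone_minorant_le _ K0))//.
  by rewrite addr0 subr0 sublinear0.
rewrite -ler_pdivrMl//; apply: cone_minorant_ge => c r Kcr.
rewrite ler_pdivrMl// mulrBr -(sublinearZ _ sq (ltW t0)) scalerDr.
by apply: cone_minorant_le; apply: KZ => //; exact: ltW.
Qed.

Lemma cone_minorant_leq x : cone_minorant x <= q x.
Proof. by have [/(cone_minorant_le x)] := cK; rewrite addr0 subr0. Qed.

(** The constraint [(c, r)] itself enters the infimum at [- c]. For a linear functional below the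
    minorant, this becomes the lower bound [r] at [c]. *)
Lemma cone_minorant_opp c r : K c r -> cone_minorant (- c) <= - r.
Proof. by move/(cone_minorant_le (- c)); rewrite addNr sublinear0// sub0r. Qed.

End ConeMinorant.

(** Zorn's lemma for the reversed pointwise order. A nonempty chain is bounded by its pointwise
    infimum, which is finite because every [q] below [p] satisfies
    [- p (- x) <= - q (- x) <= q x]. *)
Lemma minimal_sublinear p : sublinear p ->
  exists q, [/\ sublinear q, (forall x, q x <= p x) &
    forall q', sublinear q' -> (forall x, q' x <= q x) -> q' = q].
Proof.
move=> sp; pose T := {q : V -> R | sublinear q /\ forall x, q x <= p x}.
pose below (s t : T) : bool := `[< forall x, sval t x <= sval s x >].
have [||||[q [sq qp]] qmin] := @Zorn T below.
- by move=> t; apply/asboolP.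
- move=> r s t /asboolP rs /asboolP st; apply/asboolP => x.
  exact: le_trans (rs x).
- move=> [s ?] [t ?] /asboolP /= st /asboolP /= ts; apply: eq_exist.
  by apply/funext => x; apply/le_anti; rewrite ts st.
(* The empty chain is bounded by [p] itself. *)
- move=> A Atot; have [[t0 At0]|A0] := pselect (A !=set0); last first.
    exists (exist _ p (conj sp (fun x => lexx (p x)))) => s As.
    by case: A0; exists s.
  pose values x := [set sval t x | t in A].
  have lb x : has_lbound (values x).
    exists (- p (- x)) => _ [[q [sq qp]] Aq <-] /=.
    by rewrite (le_trans _ (sublinear_opp x sq))// lerN2.
  have infle t x : A t -> inf (values x) <= sval t x.
    by move=> At; apply: ge_inf => //; exists t.
  have leinf x s : (forall t, A t -> s <= sval t x) -> s <= inf (values x).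
    move=> H; apply: lb_le_inf; first by exists (sval t0 x), t0.
    by move=> _ [t At <-]; exact: H.
  have sI : sublinear (fun x => inf (values x)).
    split=> [x y|t x].
      rewrite -lerBlDr; apply: (leinf) => s As.
      rewrite lerBlDr -lerBlDl; apply: (leinf) => t At; rewrite lerBlDl.
      (* Whichever of [s] and [t] is pointwise smaller is evaluated at [x + y]; its subadditivity
         then gives the bound [sval s x + sval t y]. *)
      have [/asboolP st|/asboolP ts] := Atot _ _ As At.
        rewrite (le_trans (infle t _ At))// (le_trans ((svalP t).1.1 _ _))//.
        by rewrite lerD2r.
      rewrite (le_trans (infle s _ As))// (le_trans ((svalP s).1.1 _ _))//.
      by rewrite lerD2l.
    rewrite le_eqVlt => /predU1P[<-|t_gt0].
      rewrite scale0r mul0r (le_trans (infle t0 _ At0))//.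
      by rewrite (sublinear0 (svalP t0).1).
    rewrite -ler_pdivrMl//; apply: (leinf) => s As.
    rewrite ler_pdivrMl// -(sublinearZ _ (svalP s).1 (ltW t_gt0)).
    exact: infle.
  have Ip x : inf (values x) <= p x.
    exact: le_trans (infle t0 x At0) ((svalP t0).2 x).
  exists (exist _ (fun x => inf (values x)) (conj sI Ip)) => s As.
  by apply/asboolP => x /=; exact: infle.
exists q; split=> // q' sq' q'q.
have q'p x : q' x <= p x by exact: le_trans (q'q x) (qp x).
have := qmin (exist _ q' (conj sq' q'p)).
by rewrite /below => /(_ (asboolT q'q)) /(congr1 sval).
Qed.

(* Minimality applied to the cone spanned by [(x, q x)] makes [q] odd, and an odd
   sublinear function is linear. *)
Lemma minimal_sublinear_scalar q : sublinear q ->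
  (forall q', sublinear q' -> (forall x, q' x <= q x) -> q' = q) -> scalar q.
Proof.
move=> sq qmin.
have qN x : q (- x) = - q x.
  apply/le_anti; rewrite [X in _ && X]lerNl sublinear_opp// andbT.
  pose K c r := exists2 t, 0 <= t & c = t *: x /\ r = t * q x.
  have cK : convex_cone K.
    split; first by exists 0; rewrite ?scale0r ?mul0r.
      move=> _ _ _ _ [t t0 [-> ->]] [s s0 [-> ->]].
      by exists (t + s); rewrite ?addr_ge0// scalerDl mulrDl.
    move=> t _ _ t0 [s s0 [-> ->]].
    by exists (t * s); rewrite ?mulr_ge0// scalerA mulrA.
  have Kq c r : K c r -> r <= q c by move=> [t t0 [-> ->]]; rewrite sublinearZ.
  have e : cone_minorant q K = q.
    apply: qmin; first exact: cone_minorant_sublinear.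
    by move=> y; exact: cone_minorant_leq.
  rewrite -[X in X (- x)]e.
  by apply: cone_minorant_opp => //; exists 1; rewrite ?scale1r ?mul1r.
have qD x y : q (x + y) = q x + q y.
  apply/le_anti; rewrite sq.1 -lerBrDr -qN.
  by have := sq.1 (x + y) (- y); rewrite addrK.
move=> t x y; rewrite qD; congr (_ + _).
have [t0|t0] := leP 0 t; first by rewrite sublinearZ.
by rewrite -{1}[t]opprK scaleNr qN sublinearZ ?oppr_ge0 ?ltW// mulNr opprK.
Qed.

(** A minimal sublinear [g] below the cone minorant of [q] is linear, and the constraints survive
    because [- g c <= g (- c) <= cone_minorant q K (- c) <= - r]. *)
Theorem hahn_banach_cone q K : sublinear q -> convex_cone K ->
  (forall c r, K c r -> r <= q c) ->
  exists g : V -> R,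
    [/\ scalar g, (forall x, g x <= q x) & (forall c r, K c r -> r <= g c)].
Proof.
move=> sq cK Kq.
have [g [sg gle gmin]] := minimal_sublinear (cone_minorant_sublinear sq cK Kq).
exists g; split; first exact: minimal_sublinear_scalar.
  by move=> x; rewrite (le_trans (gle x))// cone_minorant_leq.
move=> c r Kcr; rewrite -lerN2 (le_trans _ (cone_minorant_opp sq cK Kq Kcr))//.
by rewrite (le_trans _ (gle _))// lerNl sublinear_opp.
Qed.

End Sublinear.

(** * Restriction to real scalars and complex absolute values *)

Section RealScalars.
Variables (R : realType) (E : lmodType R[i]).

(** An alias, so that the real module structure does not compete with the complex one on [E]. *)
Definition real_scalars : Type := E.
HB.instance Definition _ := GRing.Zmodule.on real_scalars.

Let scale (t : R) (x : real_scalars) : real_scalars := t%:C *: (x : E).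

Let scaleA a b x : scale a (scale b x) = scale (a * b) x.
Proof. by rewrite /scale scalerA rmorphM. Qed.

Let scale1 : left_id 1 scale.
Proof. by move=> x; rewrite /scale rmorph1 scale1r. Qed.

Let scaleDr : right_distributive scale +%R.
Proof. by move=> a x y; exact: scalerDr. Qed.

Let scaleDl x : {morph scale^~ x : a b / a + b}.
Proof. by move=> a b; rewrite /scale rmorphD; exact: scalerDl. Qed.

HB.instance Definition _ := GRing.Zmodule_isLmodule.Build R real_scalars
  scaleA scale1 scaleDr scaleDl.

Lemma real_scaleE (t : R) (x : E) :
  t *: (x : real_scalars) = (t%:C *: x : E).
Proof. by []. Qed.

End RealScalars.

Section ComplexNorm.
Variable R : realType.
Local Notation C := R[i].

Lemma norm_i : `|'i%C : C| = 1.
Proof. by rewrite complexiE normCi. Qed.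

Lemma normc_real (a : R) : `|a%:C| = `|a|%:C :> C.
Proof. by rewrite normc_def /= expr0n addr0 sqrtr_sqr. Qed.

Lemma normc_le_Re_Im (z : C) : `|z| <= `|complex.Re z|%:C + `|complex.Im z|%:C.
Proof.
rewrite {1}[z]complexE (le_trans (ler_normD _ _))// normrM norm_i mul1r.
by rewrite !normc_real.
Qed.

End ComplexNorm.

(** * Separation of a point from a closed complex subspace *)

Section Separation.
Variables (R : realType) (E : normedModType R[i]).
Local Notation C := R[i].

Definition subspace (S : set E) :=
  [/\ S 0, (forall x y, S x -> S y -> S (x + y)) &
      (forall (k : C) x, S x -> S (k *: x))].

Let normRe (x : E) : (complex.Re `|x|)%:C = `|x|.
Proof. by rewrite RRe_real// normr_real. Qed.

Lemma Re_norm_sublinear :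
  sublinear (fun x : real_scalars E => complex.Re `|x : E|).
Proof.
split=> [x y|t x t0].
  by rewrite -lecR rmorphD /= !normRe; exact: ler_normD.
by rewrite -lecR rmorphM /= !normRe real_scaleE normrZ ger0_norm// ler0c.
Qed.

(* A real-linear [g] is the real part of the complex-linear
   [x |-> g x - i g (i x)]. *)
Lemma complexify_dual (g : real_scalars E -> R) : scalar g ->
  (forall x, g x <= complex.Re `|x : E|) ->
  exists f : dual_space E,
    forall x, f x = g x +i* (- g ('i%C *: (x : E))) :> C.
Proof.
move=> gl gle.
have gD x y : g (x + y) = g x + g y by have := gl 1 x y; rewrite scale1r mul1r.
have g0 : g 0 = 0 by have := gl (-1) 0 0; rewrite scaler0 addr0 mulN1r addNr.
have gZ t x : g (t *: x) = t * g x by have := gl t x 0; rewrite g0 !addr0.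
have gN x : g (- x) = - g x by rewrite -scaleN1r gZ mulN1r.
have gabs x : `|g x| <= complex.Re `|x : E|.
  by rewrite ler_norml gle andbT lerNl -gN (le_trans (gle _))// normrN.
have gC (a b : R) (x : E) : g ((a +i* b) *: x) = a * g x + b * g ('i%C *: x).
  have -> : (a +i* b) *: x = a%:C *: x + b%:C *: ('i%C *: x).
    by rewrite scalerA -scalerDl; congr (_ *: _); simpc.
  by rewrite -!gZ -gD.
pose f (x : E) : C^o := g x +i* (- g ('i%C *: x)).
suff fb : f \in @bounded_linear R E C^o by exists (Blin fb).
apply/bounded_linearP; split.
  move=> [a b] x y; rewrite /f !(gD, scalerDr) scalerA.
  have -> : 'i%C * (a +i* b) = (- b) +i* a :> C by simpc.
  rewrite (gC a b) (gC (- b) a); apply/eqP; rewrite eq_complex /=; apply/andP; split.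
    by rewrite mulrN opprK.
  by rewrite !opprD mulNr opprK mulrN (addrC (b * _)).
(* The real and imaginary parts are each at most the norm of [x], since multiplication by ['i]
   preserves the norm. *)
exists (1 + 1) => x; rewrite rmorphD mulrDl rmorph1 mul1r.
rewrite (le_trans (normc_le_Re_Im _))// normrN.
apply: lerD; rewrite -normRe lecR (le_trans (gabs _))//.
by rewrite -lecR !normRe normrZ norm_i mul1r.
Qed.

(** As [v] has distance at least some [d > 0] from [S], the norm dominates the constraints asking
    for a value at least 0 on [S] and at least [d] at [v]. Hahn-Banach gives a real functional
    meeting them, which is then complexified. *)
Lemma separate_closed_subspace (S : set E) (v : E) :
  subspace S -> closed S -> ~ S v ->
  exists f : dual_space E, (forall s, S s -> f s = 0) /\ f v <> 0.
Proof.
move=> [S0 SD SZ] clS nSv.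
have [d d0 Sd] : exists2 d : R, 0 < d & forall s, S s -> d%:C <= `|v - s|.
  have /nbhs_ballP[e /= e0 Se] : nbhs v (~` S).
    by apply: open_nbhs_nbhs; split => //; exact: closed_openC.
  have eE : (complex.Re e)%:C = e by rewrite RRe_real// gtr0_real.
  exists (complex.Re e); first by rewrite -ltcR eE.
  move=> s Ss; rewrite eE real_leNgt ?normr_real ?gtr0_real//.
  by apply/negP => ve; apply: (Se s) => //; rewrite -ball_normE.
pose K (c : real_scalars E) r :=
  exists s t, [/\ S s, 0 <= t, c = s + t%:C *: v & r = t * d].
have cK : convex_cone K.
  split.
  - by exists 0, 0; rewrite scale0r addr0 mul0r.
  - move=> _ _ _ _ [s [t [Ss t0 -> ->]]] [s' [t' [Ss' t'0 -> ->]]].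
    exists (s + s'), (t + t'); split; rewrite ?addr_ge0//; first exact: SD.
      by rewrite rmorphD scalerDl addrACA.
    by rewrite mulrDl.
  - move=> k _ _ k0 [s [t [Ss t0 -> ->]]].
    exists (k%:C *: s), (k * t); split; rewrite ?mulr_ge0//; first exact: SZ.
      by rewrite real_scaleE scalerDr scalerA rmorphM.
    by rewrite mulrA.
have Kq c r : K c r -> r <= complex.Re `|c : E|.
  move=> [s [t [Ss t0 -> ->]]]; rewrite -lecR normRe rmorphM /=.
  move: t0; rewrite le_eqVlt => /predU1P[<-|t0]; first by rewrite mul0r.
  have tC0 : 0 < t%:C by rewrite ltcR.
  (* The subtracted vector lies in [S], so the distance bound [Sd] applies after factoring out
     [t]. *)
  have -> : s + t%:C *: v = t%:C *: (v - (- (t%:C^-1 *: s))).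
    by rewrite opprK scalerDr scalerA divff ?gt_eqF// scale1r addrC.
  rewrite normrZ gtr0_norm// ler_pM2l// Sd// -scaleN1r.
  exact/SZ/SZ.
have [g [gl gle gK]] := hahn_banach_cone Re_norm_sublinear cK Kq.
have [f fE] := complexify_dual gl gle.
(* Both [s] and [- s] lie in [S], and [g] is nonnegative on [S]. *)
have gS s : S s -> g s = 0.
  move=> Ss; have gge x : S x -> 0 <= g x.
    by move=> Sx; apply: gK; exists x, 0; rewrite scale0r addr0 mul0r.
  have gN : g (- s) = - g s.
    have g0 : g 0 = 0 by have := gl (-1) 0 0; rewrite scaler0 addr0 mulN1r addNr.
    by have := gl (-1) s 0; rewrite g0 !addr0 scaleN1r mulN1r.
  apply/le_anti; rewrite gge// andbT -oppr_ge0 -gN gge// -scaleN1r.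
  exact: SZ.
exists f; split=> [s Ss|]; rewrite fE.
  by rewrite gS// gS ?oppr0//; exact: SZ.
have : 0 < g v.
  apply: lt_le_trans d0 _; apply: gK.
  by exists 0, 1; rewrite rmorph1 scale1r add0r mul1r.
by move=> + /(congr1 (@complex.Re R)) /= ge; rewrite ge ltxx.
Qed.

End Separation.

(** * Initial, weak and weak* topologies *)

Section InitialTopologies.

Lemma cvg_initial_topology (S : choiceType) (T : topologicalType) (f : S -> T)
    (F : set_system S) (s : S) :
  Filter F -> F --> (s : initial_topology f) <-> f @ F --> f s.
Proof.
move=> FF; split=> [Fs|fFs A [_ [[B oB <-] Bfs BA]]].
  exact: (cvg_comp _ _ Fs (@initial_continuous _ _ f s)).
apply: filterS BA _; apply: fFs; exact: open_nbhs_nbhs.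
Qed.

Lemma closure_sub_preimage (T U : topologicalType) (f : T -> U) (A : set T)
    (B : set U) :
  continuous f -> closed B -> A `<=` f @^-1` B -> closure A `<=` f @^-1` B.
Proof.
rewrite continuous_closedP closureE => cf cB AB.
by apply: smallest_sub => //; exact: cf.
Qed.

End InitialTopologies.

Section WeakTopologies.
Context {R : realType}.
Local Notation C := R[i].
Implicit Types B E : normedModType C.

Lemma cvg_weak_starP B E (phi : B -> dual_space E) (F : set_system B) (b : B) :
  Filter F -> F --> (b : weak_star_topology phi) <->
  forall x, (phi b' x : C^o) @[b' --> F] --> (phi b x : C^o).
Proof.
move=> FF; apply: iff_trans (cvg_initial_topology _ _ FF) _.
exact: (@pointwise_cvgP E C^o).
Qed.

Lemma cvg_weakP E (F : set_system E) (v : E) :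
  Filter F -> F --> (v : weak_topology E) <->
  forall f : dual_space E, (f v' : C^o) @[v' --> F] --> (f v : C^o).
Proof.
move=> FF; apply: iff_trans (cvg_initial_topology _ _ FF) _.
exact: (@pointwise_cvgP (dual_space E) C^o).
Qed.

Lemma weak_star_eval_continuous B E (phi : B -> dual_space E) (x : E) :
  continuous ((fun b => phi b x) : weak_star_topology phi -> C^o).
Proof.
move=> b; have FF := @nbhs_filter (weak_star_topology phi) b.
exact: (iffLR (cvg_weak_starP phi b FF) (@cvg_id _ _) x).
Qed.

Lemma weak_eval_continuous E (f : dual_space E) :
  continuous ((fun v => f v) : weak_topology E -> C^o).
Proof.
move=> v; have FF := @nbhs_filter (weak_topology E) v.
exact: (iffLR (cvg_weakP v FF) (@cvg_id _ _) f).
Qed.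

Lemma weak_star_continuous_to (T : topologicalType) B E
    (phi : B -> dual_space E) (g : T -> B) :
  (forall x, continuous ((fun t => phi (g t) x) : T -> C^o)) ->
  continuous (g : T -> weak_star_topology phi).
Proof.
move=> gc t; apply: (iffRL (cvg_weak_starP _ _ (fmap_filter g (nbhs_filter t)))).
by move=> x; exact: gc.
Qed.

Lemma blin_bounded_near (E F : normedModType C) (f : blin E F) :
  bounded_near f (nbhs 0).
Proof.
apply/bounded_funP => r; exists (`|f| * `|r|) => x xr.
rewrite (le_trans (blin_norm_le _ _))// ler_wpM2l//.
by rewrite ger0_norm// (le_trans _ xr).
Qed.

Lemma blin_continuous (E F : normedModType C) (f : blin E F) : continuous f.
Proof. exact/bounded_linear_continuous/blin_bounded_near. Qed.

End WeakTopologies.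

(** * Limits along ultrafilters and Banach-Alaoglu *)

Section UltraLimits.
Variables (R : realType) (I : Type) (U : set_system I).
Hypothesis UU : UltraFilter U.
Local Notation C := R[i].

(** A cluster point along an ultrafilter is a limit: if the preimage of a neighbourhood were not in
    [U], its complement would be, contradicting clustering. *)
Lemma ultra_cvg_compact (T : topologicalType) (K : set T) (f : I -> T) :
  compact K -> (\forall i \near U, K (f i)) -> exists l : T, f @ U --> l.
Proof.
move=> cK UK; have [l [_ fl]] := cK (f @ U) _ UK.
exists l => A Al; have [//|UnA] := in_ultra_setVsetC (f @^-1` A) UU.
by have [z [nAz Az]] := fl (~` A) A UnA Al.
Qed.

Lemma ultra_cvg_real (f : I -> R) (M : R) : (forall i, `|f i| <= M) ->
  exists l : R, f @ U --> l.
Proof.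
move=> fM; apply: ultra_cvg_compact (@segment_compact R (- M) M) _.
by apply: nearW => i /=; rewrite in_itv /= -ler_norml.
Qed.

Lemma ultra_cvg_complex (f : I -> C) (M : R) : (forall i, `|f i| <= M%:C) ->
  exists l : C, (f : I -> C^o) @ U --> (l : C^o).
Proof.
move=> fM.
have ReM i : `|complex.Re (f i)| <= M.
  by rewrite -lecR (le_trans _ (fM i))// normc_ge_Re.
have ImM i : `|complex.Im (f i)| <= M.
  rewrite -lecR (le_trans _ (fM i))//.
  (* Up to sign, the imaginary part of [f i] is the real part of [f i * 'i]. *)
  by have := normc_ge_Re (f i * 'i%C); rewrite ReiNIm normrN normrM norm_i mulr1.
have [a fa] := ultra_cvg_real ReM; have [b fb] := ultra_cvg_real ImM.
exists (a +i* b); apply/cvgrPdist_lt => e e0.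
have eE : (complex.Re e)%:C = e by rewrite RRe_real// gtr0_real.
have e20 : 0 < complex.Re e / 2 by rewrite divr_gt0// -ltcR eE.
have /cvgrPdist_lt/(_ _ e20) na := fa; have /cvgrPdist_lt/(_ _ e20) nb := fb.
apply: filterS2 na nb => i ai bi.
rewrite (le_lt_trans (normc_le_Re_Im _))// -eE -rmorphD ltcR.
rewrite [ltRHS]splitr.
by case: (f i) ai bi => x y /= ai bi; exact: ltrD.
Qed.

(** Banach-Alaoglu along [U]: the values at each predual vector are bounded scalars, so they
    converge; the pointwise limit is a bounded functional, and [psi] brings it back to [B]. *)
Lemma ultra_weak_star_cvg (B : banachAlgType C) (D : dual_banach_algebra B)
    (b : I -> B) (M : R) : (forall i, `|b i| <= M%:C) ->
  exists l : B, b @ U --> (l : weak_star D).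
Proof.
move=> bM; have [phil phic [psi [_ psiK _]]] := to_dual_homeo D.
pose phi := GRing.isLinear.Build C B (dual_space (predual D)) _ _ phil.
pose Phi : {linear B -> dual_space (predual D)} := HB.pack (@to_dual _ _ D) phi.
have [N N0 phiN] : exists2 N : C, 0 <= N & forall x, `|to_dual D x| <= N * `|x|.
  have := iffRL (linear_bounded_continuous Phi) phic.
  by move=> /linear_boundedP/pinfty_ex_gt0[N /ltW N0 PhiN]; exists N.
have [i0 _] := filter_ex (@filterT _ U _).
have phibx i x : `|to_dual D (b i) x| <= N * M%:C * `|x|.
  rewrite (le_trans (blin_norm_le _ _))// ler_wpM2r// (le_trans (phiN _))//.
  by rewrite ler_wpM2l.
have ex_lim x : exists l : C^o, (to_dual D (b i) x : C^o) @[i --> U] --> l.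
  apply: (@ultra_cvg_complex _ (complex.Re (N * M%:C * `|x|))) => i.
  rewrite RRe_real// ger0_real//; exact: le_trans (phibx i x).
pose l x := sval (cid (ex_lim x)).
have lP x : (to_dual D (b i) x : C^o) @[i --> U] --> (l x : C^o).
  exact: svalP (cid (ex_lim x)).
have l_lin : linear l.
  move=> a x y.
  have llin : (to_dual D (b i) (a *: x + y) : C^o) @[i --> U] --> a *: l x + l y.
    under eq_fun do rewrite linearP.
    by apply: cvgD; [apply: cvgZl_tmp|]; exact: lP.
  exact: (@cvg_unique _ (@norm_hausdorff C C^o) _ _ _ _ (lP _) llin).
have l_bl : l \in @bounded_linear R (predual D) C^o.
  apply/bounded_linearP; split => //; exists (complex.Re (N * M%:C)) => x.
  have NM0 : 0 <= N * M%:C by rewrite mulr_ge0// (le_trans _ (bM i0)).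
  rewrite RRe_real ?ger0_real// real_leNgt ?normr_real//; last first.
    by rewrite ger0_real// mulr_ge0.
  (* If the bound failed at [x], an index whose value lies closer to [l x] than the excess would
     give [|l x| < |l x|]. *)
  apply/negP; rewrite -subr_gt0 => lt.
  have /cvgrPdist_lt/(_ _ lt) near_l := lP x.
  have [j lj] := filter_ex near_l.
  suff : `|l x| < `|l x| by rewrite ltxx.
  rewrite -{1}[l x](subrK (to_dual D (b j) x : C^o)).
  rewrite (le_lt_trans (ler_normD _ _))// -ltrBrDr (lt_le_trans lj)//.
  by rewrite lerD2l lerN2.
exists (psi (Blin l_bl)).
apply: (iffRL (cvg_weak_starP _ _ _)) => x.
rewrite psiK; exact: lP.
Qed.

End UltraLimits.

(** * Algebraic operations on closures *)

Section ClosureOps.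

(** Separate continuity suffices, because the closure is passed one variable at a time. *)
Lemma closure_op_closed (T : topologicalType) (op : T -> T -> T) (S : set T) :
  (forall x, continuous (op x)) -> (forall y, continuous (op^~ y)) ->
  (forall x y, S x -> S y -> S (op x y)) ->
  forall x y, closure S x -> closure S y -> closure S (op x y).
Proof.
move=> opr opl opS x y clx; move: y.
apply: closure_sub_preimage (opr x) (@closed_closure _ S) _ => y Sy /=.
move: x clx; apply: closure_sub_preimage (opl y) (@closed_closure _ S) _ => x Sx /=.
by apply: subset_closure; exact: opS.
Qed.

Lemma closure_subspace (R : realType) (E : normedModType R[i]) (S : set E) :
  subspace S -> subspace (closure S).
Proof.
move=> [S0 SD SZ]; split.
- exact: subset_closure.
- apply: closure_op_closed SD => [x y|y x].
    by apply: cvgD; [exact: cvg_cst|exact: cvg_id].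
  by apply: cvgD; [exact: cvg_id|exact: cvg_cst].
- move=> k; apply: closure_sub_preimage (@closed_closure _ S) _.
    by move=> x; apply: cvgZl_tmp; exact: cvg_id.
  by move=> x Sx; apply: subset_closure; exact: SZ.
Qed.

End ClosureOps.

(** * Ideals and the weak* topology of a dual Banach algebra *)

Section BanachAlgebras.
Context {R : realType}.
Local Notation C := R[i].

Lemma bmulBl (B : banachAlgType C) (a b c : B) :
  bmul (a - b) c = bmul a c - bmul b c.
Proof. by rewrite bmulDl -scaleN1r bmulZl scaleN1r. Qed.

Lemma bmulBr (B : banachAlgType C) (a b c : B) :
  bmul a (b - c) = bmul a b - bmul a c.
Proof. by rewrite bmulDr -scaleN1r bmulZr scaleN1r. Qed.

Lemma left_ideal_subspace (B : banachAlgType C) (J : set B) :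
  left_ideal J -> subspace J.
Proof. by case. Qed.

Lemma subspace_sum (E : normedModType C) (S : set E) (n : nat) (x : 'I_n -> E) :
  subspace S -> (forall k, S (x k)) -> S (\sum_(k < n) x k).
Proof. by move=> [S0 SD _] Sx; elim/big_ind : _. Qed.

Lemma to_dual_linear (B : banachAlgType C) (D : dual_banach_algebra B) :
  linear (to_dual D).
Proof. by have [] := to_dual_homeo D. Qed.

Lemma to_dual_continuous (B : banachAlgType C) (D : dual_banach_algebra B) :
  continuous (to_dual D).
Proof. by have [] := to_dual_homeo D. Qed.

Lemma weak_star_add_continuous (B : banachAlgType C) (D : dual_banach_algebra B)
    (b : B) : continuous ((+%R b) : weak_star D -> weak_star D).
Proof.
apply: weak_star_continuous_to => x c.
have -> : (fun t : weak_star D => to_dual D (b + t) x : C^o) =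
          (fun t => to_dual D b x + to_dual D t x : C^o).
  apply/funext => t; have := to_dual_linear D 1 b t.
  by rewrite !scale1r => ->.
exact: cvgD (cvg_cst _) (@weak_star_eval_continuous _ _ _ (@to_dual _ _ D) x c).
Qed.

Lemma weak_star_scale_continuous (B : banachAlgType C)
    (D : dual_banach_algebra B) (k : C) :
  continuous (( *:%R k) : weak_star D -> weak_star D).
Proof.
apply: weak_star_continuous_to => x c.
have to_dual0 : to_dual D 0 = 0.
  by have := to_dual_linear D (-1) 0 0; rewrite scaler0 addr0 scaleN1r addNr.
have -> : (fun t : weak_star D => to_dual D (k *: t) x : C^o) =
          (fun t => k *: (to_dual D t x : C^o)).
  apply/funext => t; have := to_dual_linear D k t 0.
  by rewrite to_dual0 !addr0 => ->.
exact: cvgZl_tmp (@weak_star_eval_continuous _ _ _ (@to_dual _ _ D) x c).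
Qed.

Lemma weak_star_closure_left_ideal (B : banachAlgType C)
    (D : dual_banach_algebra B) (J : set B) :
  left_ideal J -> left_ideal (closure (J : set (weak_star D)) : set B).
Proof.
move=> [J0 JD JZ JM].
have sub f : continuous (f : weak_star D -> weak_star D) ->
    (forall x, J x -> J (f x)) -> forall x : weak_star D,
    closure (J : set (weak_star D)) x -> closure (J : set (weak_star D)) (f x).
  move=> cf Jf; apply: (closure_sub_preimage cf (@closed_closure _ _)) => x Jx.
  by apply: subset_closure; exact: Jf.
have addC y : continuous ((+%R^~ y) : weak_star D -> weak_star D).
  have -> : +%R^~ y = +%R y :> (B -> B) by apply/funext => x; rewrite addrC.
  exact: weak_star_add_continuous.
split.
- exact: (@subset_closure (weak_star D)).
- exact: (@closure_op_closed (weak_star D) +%R J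
    (weak_star_add_continuous (D := D)) addC JD).
- by move=> k; apply: (sub _ (@weak_star_scale_continuous B D k)); exact: JZ.
- by move=> b; apply: (sub _ (@wstar_continuous_mull _ _ D b)); exact: JM.
Qed.

Lemma norm_weak_star_continuous (B : banachAlgType C)
    (D : dual_banach_algebra B) :
  continuous (id : B -> weak_star D).
Proof.
apply: weak_star_continuous_to => x b; apply/cvgrPdist_lt => e e0.
(* The summand 1 keeps the denominator positive when [x = 0]. *)
have d0 : 0 < e / (`|x| + 1) by rewrite divr_gt0// ltr_wpDl.
have /cvgrPdist_lt/(_ _ d0) near_b := @to_dual_continuous B D b.
apply: filterS near_b => c bc.
rewrite -blinBE (le_lt_trans (blin_norm_le _ _))//.
apply: (@le_lt_trans _ _ (`|to_dual D b - to_dual D c| * (`|x| + 1))).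
  by rewrite ler_wpM2l// lerDl.
by rewrite -ltr_pdivlMr// ltr_wpDl.
Qed.

End BanachAlgebras.

(** * The canonical map from A to M(A) *)

Section Embedding.
Context {R : realType}.
Local Notation C := R[i].
Variable A : banachAlgType C.

Lemma bmull_bounded (a : A) : bmul a \in @bounded_linear R A A.
Proof.
apply/bounded_linearP; split; first by move=> k x y; rewrite bmulDr bmulZr.
by exists (complex.Re `|a|) => x; rewrite RRe_real ?normr_real// bmul_norm.
Qed.

Lemma bmulr_bounded (a : A) : bmul^~ a \in @bounded_linear R A A.
Proof.
apply/bounded_linearP; split; first by move=> k x y; rewrite bmulDl bmulZl.
exists (complex.Re `|a|) => x.
by rewrite RRe_real ?normr_real// mulrC bmul_norm.
Qed.

Lemma embed_subproof (a : A) :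
  (Blin (bmull_bounded a), Blin (bmulr_bounded a)) \in @is_multiplier R A.
Proof. by apply/is_multiplierP => x y /=; rewrite bmulA. Qed.

Definition embed (a : A) : multiplier A := Multiplier (embed_subproof a).

Lemma lmult_embed a b : lmult (embed a) b = bmul a b. Proof. by []. Qed.

Lemma rmult_embed a b : rmult (embed a) b = bmul b a. Proof. by []. Qed.

Lemma embed_linear : linear embed.
Proof.
move=> k a b; apply: multiplierEP; apply/blinEP => x.
  by rewrite lmultD lmultZ blinDE blinZE !lmult_embed bmulDl bmulZl.
by rewrite rmultD rmultZ blinDE blinZE !rmult_embed bmulDr bmulZr.
Qed.

HB.instance Definition _ :=
  GRing.isLinear.Build C A (multiplier A) _ embed embed_linear.

Lemma embed_norm a : `|embed a| <= `|a|.
Proof.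
rewrite multiplier_normE comparable_ge_max; last first.
  by apply: real_comparable; exact: normr_real.
apply/andP; split; apply: opnorm_le => // x; first exact: bmul_norm.
by rewrite mulrC; exact: bmul_norm.
Qed.

Lemma embed_continuous : continuous embed.
Proof.
apply/bounded_linear_continuous/bounded_funP => r; exists r => x.
exact/le_trans/embed_norm.
Qed.

Lemma rmultM (mu nu : multiplier A) a : rmult (bmul mu nu) a = rmult nu (rmult mu a).
Proof. by []. Qed.

Lemma rmult_sum n (mu : 'I_n -> multiplier A) a :
  rmult (\sum_(k < n) mu k) a = \sum_(k < n) rmult (mu k) a.
Proof.
apply: (big_morph (fun mu => rmult mu a)) => [mu' nu'|]; last by [].
by rewrite rmultD blinDE.
Qed.

Hypothesis fA : faithful A.

(** For every [x], with mu = (L, R), both sides give R(x)ab when multiplied on the left by [x];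
    faithfulness cancels [x]. The next lemma is the mirror image. *)
Lemma lmult_bmul (mu : multiplier A) a b :
  lmult mu (bmul a b) = bmul (lmult mu a) b.
Proof.
apply: subr0_eq; apply: fA.1 => x.
by rewrite bmulBr lrmultP !bmulA lrmultP subrr.
Qed.

Lemma rmult_bmul (mu : multiplier A) a b :
  rmult mu (bmul a b) = bmul a (rmult mu b).
Proof.
apply: subr0_eq; apply: fA.2 => x.
by rewrite bmulBl -lrmultP -!bmulA -lrmultP subrr.
Qed.

(** Together with [embed_bmul], this makes the image of A a two-sided ideal of M(A). *)
Lemma bmul_embed (mu : multiplier A) a : bmul mu (embed a) = embed (lmult mu a).
Proof.
apply: multiplierEP; apply/blinEP => x; first exact: lmult_bmul.
by rewrite rmultM !rmult_embed lrmultP.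
Qed.

Lemma embed_bmul (mu : multiplier A) a : bmul (embed a) mu = embed (rmult mu a).
Proof.
apply: multiplierEP; apply/blinEP => x; first exact: lrmultP.
by rewrite rmultM !rmult_embed rmult_bmul.
Qed.

End Embedding.

(** * Compliant algebras: approximation of multipliers by elements of A *)

Section Compliant.
Context {R : realType}.
Local Notation C := R[i].
Variables (A : banachAlgType C) (cA : compliant A).
Local Notation M := (multiplier A).
Local Notation D := (compliant_dual cA).
Local Notation clw S := (closure (S : set (weak_star D)) : set M).

Lemma embed_weak_star_continuous : continuous (@embed R A : A -> weak_star D).
Proof.
move=> a.
exact: (continuous_comp (@embed_continuous R A a)
  (@norm_weak_star_continuous R M D (embed a))).
Qed.

(* [nu |-> a nu] is continuous into the weak topology, in which the norm-closed
   subspace [S] is closed by Hahn-Banach. *)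
Lemma rmult_weak_star_closure (S : set A) (T : set M) (mu : M) (a : A) :
  subspace S -> closed S -> (forall nu, T nu -> S (rmult nu a)) ->
  clw T mu -> S (rmult mu a).
Proof.
move=> sS clS TS clT; apply: contrapT => nS.
have [f [fS fmu]] := separate_closed_subspace sS clS nS.
apply: fmu.
have fc : continuous ((fun nu => f (rmult nu a)) : weak_star D -> C^o).
  move=> nu; exact: (continuous_comp (@compliant_rmult _ _ cA a nu)
    (@weak_eval_continuous _ _ f (rmult nu a))).
have cl0 : closed ([set 0] : set C^o).
  exact/accessible_closed_set1/hausdorff_accessible/norm_hausdorff.
apply: (closure_sub_preimage fc cl0 _ clT) => nu Tnu /=.
exact/fS/TS.
Qed.

(** An ultrafilter refining the net has a weak* limit [E] by Banach-Alaoglu. Compliance makes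
    [a e_k] tend weakly to [a E], while it tends to [a] in norm, so [E] acts on the right as the
    identity. *)
Lemma bai_weak_star_one : has_bounded_approximate_identity A ->
  exists (I : Type) (U : set_system I) (e : I -> A),
    [/\ ProperFilter U,
        (forall a, bmul (e k) a @[k --> U] --> a) &
        (embed (e k) : weak_star D) @[k --> U] --> (bone : weak_star D)].
Proof.
move=> [I [le [e [dle [m em] el er]]]].
have PF := net_filter_proper dle.
have [U [UU FU]] := ultraFilterLemma PF.
have {}el a : bmul (e k) a @[k --> U] --> a.
  exact: cvg_trans (cvg_app _ FU) (el a).
have {}er a : bmul a (e k) @[k --> U] --> a.
  exact: cvg_trans (cvg_app _ FU) (er a).
have [E eE] := ultra_weak_star_cvg UU D
  (fun k => le_trans (embed_norm (e k)) (em k)).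
exists I, U, e; split; [exact: ultra_proper|exact: el|].
suff <- : E = bone by [].
have rE a : rmult E a = a.
  apply: subr0_eq; apply: contrapT => nE.
  (* Separation from the zero subspace: functionals distinguish points, so weak limits are
     unique. *)
  have [||//|f [_ fE]] := @separate_closed_subspace R A [set 0] (rmult E a - a).
  - by split=> [//|x y -> ->|k x ->]; rewrite ?addr0 ?scaler0.
  - exact/accessible_closed_set1/hausdorff_accessible/norm_hausdorff.
  apply: fE; rewrite linearB; apply/eqP; rewrite subr_eq0; apply/eqP.
  have c1 : (f (bmul a (e k)) : C^o) @[k --> U] --> (f a : C^o).
    exact: (cvg_comp _ _ (er a) (@blin_continuous _ _ _ f a)).
  have c2 : (f (bmul a (e k)) : C^o) @[k --> U] --> (f (rmult E a) : C^o).
    have := cvg_comp _ _ eE (@compliant_rmult _ _ cA a E).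
    by move=> /(cvg_weakP _ (fmap_filter _ _))/(_ f).
  exact: (@cvg_unique _ (@norm_hausdorff C C^o) _ _ _ _ c2 c1).
have fA := compliant_faithful cA.
(* The left action follows from the right one: x(Ea) = (xE)a = xa for all [x], and faithfulness
   cancels [x]. *)
apply: multiplierEP; apply/blinEP => a; last by rewrite rE.
apply: subr0_eq; apply: fA.1 => x.
by rewrite bmulBr !lrmultP rE; exact: subrr.
Qed.

(** The element [lmult mu a] is the norm limit of mu(e_k a) = (mu e_k)a, which lies in [J]. Thus
    closed left ideals of A are also stable under M(A). *)
Lemma closed_left_ideal_lmult (I : Type) (U : set_system I) (e : I -> A)
    (J : set A) (mu : M) (a : A) :
  ProperFilter U -> (forall a, bmul (e k) a @[k --> U] --> a) ->
  left_ideal J -> closed J -> J a -> J (lmult mu a).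
Proof.
move=> PU el [_ _ _ JM] clJ Ja.
apply: (closed_cvg (F := U) (u_ := fun k => lmult mu (bmul (e k) a)) J clJ).
  by apply: nearW => k; rewrite (lmult_bmul (compliant_faithful cA)); exact: JM.
exact: (cvg_comp _ _ (el a) (@blin_continuous _ _ _ (lmult mu) a)).
Qed.

Lemma embed_image_left_ideal (I : Type) (U : set_system I) (e : I -> A)
    (J : set A) :
  ProperFilter U -> (forall a, bmul (e k) a @[k --> U] --> a) ->
  left_ideal J -> closed J -> left_ideal (@embed R A @` J).
Proof.
move=> PU el lJ clJ; have [J0 JD JZ JM] := lJ; split.
- by exists 0 => //; rewrite linear0.
- by move=> _ _ [a Ja <-] [b Jb <-]; exists (a + b); rewrite ?linearD//; exact: JD.
- by move=> k _ [a Ja <-]; exists (k *: a); rewrite ?linearZ//; exact: JZ.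
- move=> mu _ [a Ja <-]; rewrite (bmul_embed (compliant_faithful cA)).
  by exists (lmult mu a) => //; exact: closed_left_ideal_lmult el lJ clJ Ja.
Qed.

Lemma embed_rmult_cvg (I : Type) (U : set_system I) (e : I -> A) (mu : M) :
  Filter U -> (embed (e k) : weak_star D) @[k --> U] --> (bone : weak_star D) ->
  (embed (rmult mu (e k)) : weak_star D) @[k --> U] --> (mu : weak_star D).
Proof.
move=> FU e1.
have -> : (fun k => embed (rmult mu (e k))) = (fun k => bmul (embed (e k)) mu).
  by apply/funext => k; rewrite (embed_bmul (compliant_faithful cA)).
have := cvg_comp _ _ e1 (@wstar_continuous_mulr _ _ D mu bone).
by rewrite bmul1x.
Qed.

Lemma range_rmult_subspace n (mu : 'I_n -> M) :
  subspace [set \sum_(k < n) rmult (mu k) (a k) | a in [set: 'I_n -> A]].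
Proof.
split.
- by exists (fun=> 0) => //; rewrite big1// => k _; rewrite linear0.
- move=> _ _ [a _ <-] [b _ <-]; exists (fun k => a k + b k) => //.
  by rewrite -big_split; apply: eq_bigr => k _; rewrite linearD.
- move=> c _ [a _ <-]; exists (fun k => c *: a k) => //.
  by rewrite scaler_sumr; apply: eq_bigr => k _; rewrite linearZ.
Qed.

(** * Transport of generators between ideals of A and of M(A) *)

Section Correspondence.
Variables (I : Type) (U : set_system I) (e : I -> A).
Hypotheses (PU : ProperFilter U)
  (el : forall a, bmul (e k) a @[k --> U] --> a)
  (e1 : (embed (e k) : weak_star D) @[k --> U] --> (bone : weak_star D)).

Lemma noetherian_ideals (J : set A) :
  wstar_left_noetherian D -> left_ideal J -> closed J ->
  exists (n : nat) (mu : 'I_n -> M),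
    J = closure [set \sum_(k < n) rmult (mu k) (a k) | a in [set: 'I_n -> A]].
Proof.
move=> noeth lJ clJ; have sJ := left_ideal_subspace lJ.
have [_ _ _ JM] := lJ.
have lcl := weak_star_closure_left_ideal D (embed_image_left_ideal PU el lJ clJ).
have [n [mu [Jmu JE]]] := noeth _ lcl (@closed_closure _ _).
exists n, mu; apply/seteqP; split; last first.
  rewrite closureE; apply: smallest_sub => // _ [a _ <-].
  apply: subspace_sum => // k.
  (* Each generator is in the weak* closure of [J], and multiplying [J] on the left by [a k] stays
     in [J]. *)
  apply: rmult_weak_star_closure sJ clJ _ (Jmu k) => _ [b Jb <-].
  by rewrite rmult_embed; exact: JM.
move=> a Ja.
set S := closure _; have sS : subspace S.
  exact: closure_subspace (range_rmult_subspace mu).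
apply: (closed_cvg (F := U) (u_ := fun k => bmul (e k) a) S
  (@closed_closure _ _)); last exact: el.
apply: nearW => k; rewrite -rmult_embed.
have := @subset_closure (weak_star D) _ _ (imageP (@embed R A) Ja).
rewrite JE; apply: rmult_weak_star_closure sS (@closed_closure _ _) _ => _ [b _ <-].
(* Multiplying the sum of the b_l mu_l by e_k moves the coefficients into A, as e_k b_l. *)
apply: subset_closure; exists (fun l => rmult (b l) (e k)) => //.
by rewrite rmult_sum.
Qed.

Lemma ideals_noetherian :
  (forall J : set A, left_ideal J -> closed J ->
   exists (n : nat) (mu : 'I_n -> M),
     J = closure [set \sum_(k < n) rmult (mu k) (a k) | a in [set: 'I_n -> A]]) ->
  wstar_left_noetherian D.
Proof.
move=> idl J lJ clJ; have [J0 JD JZ JM] := lJ.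
have fA := compliant_faithful cA.
pose I0 := @embed R A @^-1` J.
have lI : left_ideal I0.
  split; rewrite /I0 /=; first by rewrite linear0.
  - by move=> x y Jx Jy; rewrite linearD; exact: JD.
  - by move=> k x Jx; rewrite linearZ; exact: JZ.
  - by move=> b x Jx; rewrite -lmult_embed -bmul_embed//; exact: JM.
have clI : closed I0.
  exact: (iffLR (continuous_closedP _) embed_weak_star_continuous).
have [n [mu IE]] := idl I0 lI clI.
(* The products e_l mu_k lie in [I0], being sums with a single nonzero coefficient, and tend weak*
   to mu_k; [J] is weak*-closed. *)
have Jmu k : J (mu k).
  apply: (closed_cvg (F := U) (J : set (weak_star D)) clJ);
    last exact: embed_rmult_cvg e1.
  apply: nearW => l; change (I0 (rmult (mu k) (e l))); rewrite IE.
  apply: subset_closure; exists (fun j => if j == k then e l else 0) => //.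
  rewrite (bigD1 k)//= eqxx big1 ?addr0// => j /negbTE ->.
  by rewrite linear0.
exists n, mu; split=> //; apply/seteqP; split; last first.
  rewrite closureE; apply: smallest_sub => // _ [b _ <-].
  by apply: subspace_sum (left_ideal_subspace lJ) _ => k; exact: JM.
move=> m Jm; set T := [set _ | _ in _].
apply: (closed_cvg (F := U) _ (@closed_closure (weak_star D) T));
  last exact: embed_rmult_cvg e1.
apply: nearW => l.
(* Each e_l m lies in the norm closure of the sums of the A mu_k, which [embed] maps into the weak*
   closure of [T]. *)
have : I0 (rmult m (e l)) by rewrite /I0 /= -embed_bmul//; exact: JM.
rewrite IE; move: (rmult m (e l)).
apply: (closure_sub_preimage embed_weak_star_continuous
  (@closed_closure (weak_star D) T)) => _ [a _ <-].
apply: subset_closure; exists (fun k => embed (a k)) => //.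
by rewrite linear_sum; apply: eq_bigr => k _; rewrite embed_bmul.
Qed.

End Correspondence.
End Compliant.

Theorem proposition5p11 (R : realType) (A : banachAlgType R[i])
    (cA : compliant A) (baiA : has_bounded_approximate_identity A) :
  wstar_left_noetherian (compliant_dual cA) <->
  forall I : set A, left_ideal I -> closed I ->
  exists (n : nat) (mu : 'I_n -> multiplier A),
    I = closure [set \sum_(i < n) rmult (mu i) (a i) | a in [set: 'I_n -> A]].
Proof.
have [I [U [e [PU el e1]]]] := bai_weak_star_one cA baiA.
split=> [noeth J|]; first exact: noetherian_ideals PU el J noeth.
exact: ideals_noetherian PU e1.
Qed.
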